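(* Let $\bigl(\mathbf{X}(\cdot,t),\kappa(\cdot,t)\bigr)$ be a solution of the following variational problem: given the initial open curve $\Gamma(0)=\mathbf{X}(\cdot,0)\in\mathbb{X}$ with $\mathbf{X}(\rho,0)=\mathbf{X}_0(L_0\rho)$ and $x_c^l(0)=x_0(0)<x_c^r(0)=x_0(L_0)$, for $t>0$ find curves $\Gamma(t)=\mathbf{X}(\cdot,t)=(x(\cdot,t),y(\cdot,t))^T\in\mathbb{X}$ and $\kappa(\cdot,t)\in H^1(\mathbf{I})$ such that $$\bigl(\mathbf{n}\cdot\partial_t\mathbf{X},\psi\bigr)_{\Gamma(t)}+\bigl(\partial_s\kappa,\partial_s\psi\bigr)_{\Gamma(t)}=0,\qquad\forall\,\psi\in H^1(\mathbf{I}),$$ $$\bigl(\kappa,\mathbf{n}\cdot\boldsymbol{\omega}\bigr)_{\Gamma(t)}-\bigl(\partial_s\mathbf{X},\partial_s\boldsymbol{\omega}\bigr)_{\Gamma(t)}-\frac1\eta\Bigl[\frac{dx_c^l(t)}{dt}\,\omega_1(0)+\frac{dx_c^r(t)}{dt}\,\omega_1(1)\Bigr]+\sigma\bigl[\omega_1(1)-\omega_1(0)\bigr]=0,\qquad\forall\,\boldsymbol{\omega}=(\omega_1,\omega_2)^T\in\mathbb{X},$$ where $x_c^l(t)=x(\rho=0,t)$ and $x_c^r(t)=x(\rho=1,t)$ are assumed to satisfy $x_c^l(t)\le x_c^r(t)$. Then the total area (mass) is conserved, $$A(t)\equiv A(0)=\int_0^{L_0}y_0(s)\,\partial_sx_0(s)\,ds,\qquad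 t\ge0,$$ and the total free energy is decreasing, $$W(t)\le W(t')\le W(0)=L_0-\sigma\bigl(x_c^r(0)-x_c^l(0)\bigr),\qquad t\ge t'\ge0.$$
   Context: $\mathbf{I}=[0,1]$; $\sigma\in(-1,1)$ and $\eta>0$ are given constants. The initial curve is $\mathbf{X}_0(s)=(x_0(s),y_0(s))^T$, $0\le s\le L_0$, parameterized by arc length $s$, with $L_0$ its length. A time-dependent open curve is written $\Gamma(t)=\mathbf{X}(\rho,t)=(x(\rho,t),y(\rho,t))^T$, $\rho\in\mathbf{I}$. Its arc length is $s(\rho,t)=\int_0^\rho|\partial_q\mathbf{X}|\,dq$, so $\partial_\rho s=|\partial_\rho\mathbf{X}|$ and $\partial_s=|\partial_\rho\mathbf{X}|^{-1}\partial_\rho$; its length is $L(t)=|\Gamma(t)|$. The unit normal is $\mathbf{n}=(-\partial_sy,\partial_sx)^T$. The inner product is $(u,v)_{\Gamma(t)}=\int_{\Gamma(t)}u\cdot v\,ds=\int_{\mathbf{I}}u\cdot v\,\partial_\rho s\,d\rho$ for scalar or vector functions. The spaces are $L^2(\mathbf{I})=\{u:\mathbf{I}\to\mathbb{R}:\int_{\mathbf{I}}|u|^2\,\partial_\rho s\,d\rho<\infty\}$, $H^1(\mathbf{I})=\{u\in L^2(\mathbf{I}):\partial_\rho u\in L^2(\mathbf{I})\}$, $H^1_0(\mathbf{I})=\{u\in H^1(\mathbf{I}):u(0)=u(1)=0\}$, and $\mathbb{X}=H^1(\mathbf{I})\times H^1_0(\mathbf{I})$. The total area and total free energy are $$A(t)=\int_0^{L(t)}y(s,t)\,\partial_sx(s,t)\,ds,\qquad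 W(t)=L(t)-\sigma\bigl[x_c^r(t)-x_c^l(t)\bigr].$$ *)

(* Defs.v *)
From HB Require Import structures.
From mathcomp Require Import all_boot all_order all_algebra.
From mathcomp Require Import all_classical all_reals all_analysis.

Set Implicit Arguments.
Unset Strict Implicit.
Unset Printing Implicit Defensive.

Import Order.TTheory GRing.Theory Num.Theory.
Import numFieldNormedType.Exports.

Local Open Scope classical_set_scope.
Local Open Scope ring_scope.

(* A parameterized curve, or a vector field along one, is a map [R -> R * R]
   of which only the values on the unit interval matter. The product carries
   the max norm in the library, hence the explicit Euclidean norm and dot
   product below. *)

Section OpenCurves.
Context {R : realType}.
Implicit Types (G U V : R -> R * R) (u v : R -> R).

Local Notation mu := (@lebesgue_measure R).

Definition unitI : set R := `[0, 1].

Definition cx U : R -> R := fun r => (U r).1.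
Definition cy U : R -> R := fun r => (U r).2.

Definition dot (a b : R * R) : R := a.1 * b.1 + a.2 * b.2.

(* The derivative with respect to the parameter is the pointwise one; [derive1]
   takes a fixed junk value at points of non-differentiability, which form a
   null set for the functions considered here. *)
Definition dpar U : R -> R * R := fun r => (derive1 (cx U) r, derive1 (cy U) r).

(* d s / d rho *)
Definition speed G : R -> R := fun r => Num.sqrt (dot (dpar G r) (dpar G r)).

Definition ds G u : R -> R := fun r => (speed G r)^-1 * derive1 u r.

Definition dsv G U : R -> R * R := fun r => (ds G (cx U) r, ds G (cy U) r).

Definition normal G : R -> R * R :=
  fun r => (- ds G (cy G) r, ds G (cx G) r).

Definition inner G u v : R :=
  \int[mu]_(r in unitI) (u r * v r * speed G r).

Definition innerv G U V : R :=
  \int[mu]_(r in unitI) (dot (U r) (V r) * speed G r).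

Definition L2 G u : Prop :=
  measurable_fun unitI u /\
  (\int[mu]_(r in unitI) (`|u r| ^+ 2 * speed G r)%:E < +oo)%E.

(* On an interval, a function with a weak derivative is represented by its
   absolutely continuous version: it is almost everywhere differentiable and
   is the primitive of its derivative. Boundary values of H1 functions are
   values of this representative. *)
Definition abs_continuous u : Prop :=
  [/\ {ae mu, forall r, r \in `]0, 1[ -> derivable u r 1},
      mu.-integrable unitI (EFin \o derive1 u) &
      forall r, r \in `[0, 1] ->
        u r = u 0 + \int[mu]_(q in `[0, r]) derive1 u q].

Definition H1 G u : Prop := [/\ abs_continuous u, L2 G u & L2 G (derive1 u)].

Definition H10 G u : Prop := [/\ H1 G u, u 0 = 0 & u 1 = 0].

Definition XX G U : Prop := H1 G (cx U) /\ H10 G (cy U).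

Definition H1norm2 G U : \bar R :=
  (\int[mu]_(r in unitI)
     ((dot (U r) (U r) + dot (dpar U r) (dpar U r)) * speed G r)%:E)%E.

(* Nondegeneracy of the parameterization, needed for the arc length derivative
   to act on [H1 G]; the bound depends on the curve. *)
Definition regular G : Prop :=
  exists2 c : R, 0 < c & {ae mu, forall r, r \in `[0, 1] -> c <= speed G r}.

Definition arclength G (r : R) : R := \int[mu]_(q in `[0, r]) speed G q.

Definition curve_length G : R := arclength G 1.

(* The integral of y d_s x with respect to arc length along the curve. *)
Definition area G : R := inner G (cy G) (ds G (cx G)).

Definition energy (sigma : R) G : R :=
  curve_length G - sigma * (cx G 1 - cx G 0).

Implicit Types X : R -> R -> R * R.  (* [X t rho] *)

Definition dtime X (t : R) : R -> R * R :=
  fun r => (derive1 (fun t' => cx (X t') r) t, derive1 (fun t' => cy (X t') r) t).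

Definition xcl X (t : R) : R := cx (X t) 0.
Definition xcr X (t : R) : R := cx (X t) 1.

(* [X] is differentiable at [t] as a map into XX, with derivative the
   pointwise partial time derivative of [X]. *)
Definition time_differentiable X (t : R) : Prop :=
  [/\ forall r, r \in `[0, 1] ->
        derivable (fun t' => cx (X t') r) t 1 /\
        derivable (fun t' => cy (X t') r) t 1,
      XX (X t) (dtime X t) &
      H1norm2 (X t)
        (fun r => (h^-1 * (cx (X (t + h)) r - cx (X t) r) - cx (dtime X t) r,
                   h^-1 * (cy (X (t + h)) r - cy (X t) r) - cy (dtime X t) r))
        @[h --> 0^'] --> 0%E].

Definition initially_continuous X : Prop :=
  H1norm2 (X 0) (fun r => (cx (X t) r - cx (X 0) r, cy (X t) r - cy (X 0) r))
    @[t --> 0^'+] --> 0%E.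

Definition initial_curve (L0 : R) (X0 : R -> R * R) X : Prop :=
  [/\ 0 < L0,
      {ae mu, forall s, s \in `[0, L0] -> speed X0 s = 1},
      forall r, r \in `[0, 1] -> X 0 r = X0 (L0 * r),
      XX (X 0) (X 0) &
      cx X0 0 < cx X0 L0].

Definition variational_solution (sigma eta L0 : R) (X0 : R -> R * R) X
    (kappa : R -> R -> R) : Prop :=
  [/\ initial_curve L0 X0 X,
      initially_continuous X &
      forall t, 0 < t ->
      [/\ [/\ XX (X t) (X t), regular (X t), time_differentiable X t &
              H1 (X t) (kappa t)],
          xcl X t <= xcr X t,
          forall psi, H1 (X t) psi ->
            inner (X t) (fun r => dot (normal (X t) r) (dtime X t r)) psi
            + inner (X t) (ds (X t) (kappa t)) (ds (X t) psi) = 0 &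
          forall omega, XX (X t) omega ->
            inner (X t) (kappa t) (fun r => dot (normal (X t) r) (omega r))
            - innerv (X t) (dsv (X t) (X t)) (dsv (X t) omega)
            - eta^-1 * (derive1 (xcl X) t * cx omega 0 + derive1 (xcr X) t * cx omega 1)
            + sigma * (cx omega 1 - cx omega 0) = 0]].

End OpenCurves.

(* Main.v *)
Require Import Defs.
From mathcomp Require Import all_boot all_order all_algebra.
From mathcomp Require Import all_classical all_reals all_analysis.
From mathcomp Require Import measurable_realfun.
From mathcomp Require Import ring lra.

(** The proof differentiates the area A and the energy W in time and tests the
variational equations with psi = 1, psi = kappa and omega = d_t X.

For t > 0 the curve is nondegenerate, so the norms weighted by the speed
dominate the unweighted L2 norms on the unit interval; differentiability of X
in the weighted H1 norm therefore says that the difference quotients of x, y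
and of their parameter derivatives x', y' converge in L2
([time_differentiable_L2cvg]).

The area is the inner product of y and x', whatever the parameterization
([areaE]).  By continuity of the inner product ([ip_differentiable]) its rate
is <y_t, x'> + <y, x_t'>.  Integration by parts, in which y vanishes at both
ends, turns it into <y_t, x'> - <y', x_t>, which is (n . d_t X, 1)
([inner_normalE]); the first equation with psi = 1 makes it zero
([area_rate]).

The length is the integral of the Euclidean norm of (x', y').  That norm lies
above its tangent and below tangent plus square over twice a lower bound for
the speed, so its integral is differentiable along L2-differentiable families
([length_differentiable]) with rate (d_s X, d_s d_t X).  The second equation
with omega = d_t X, combined with the first one with psi = kappa, gives
  W' = - (d_s kappa, d_s kappa) - (1 / eta) (xl'^2 + xr'^2) <= 0
([energy_rate]), where xl and xr are the contact points.

At t = 0 only right-continuity is available.  The initial speed is the constant L0, so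
the same L2 arguments apply and both A and W are right-continuous there
([area_energy_right_continuous]; the distance between the contact points is the
integral of x').  The mean value theorem then gives monotonicity on the closed
half-line ([nonincreasing_from_origin]), applied to W, A and - A.  The initial
values come from the substitution s = L0 * rho. *)

Set Implicit Arguments.
Unset Strict Implicit.
Unset Printing Implicit Defensive.

Import Order.TTheory GRing.Theory Num.Theory.
Import numFieldNormedType.Exports.
Local Open Scope classical_set_scope.
Local Open Scope ring_scope.


(** * Square integrable functions on the unit interval *)

Section SquareIntegrable.
Context {R : realType}.
Local Notation mu := (@lebesgue_measure R).
Implicit Types f g h : R -> R.

Lemma measurable_unitI : measurable (@unitI R).
Proof. exact: measurable_itv. Qed.
#[local] Hint Resolve measurable_unitI : core.

Lemma lebesgue_unitI : mu (@unitI R) = 1%E.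
Proof. by rewrite /unitI lebesgue_measure_itv /= lte_fin ltr01 sube0. Qed.

Lemma ae_imply (P Q : R -> Prop) : (forall r, P r -> Q r) ->
  {ae mu, forall r, P r} -> {ae mu, forall r, Q r}.
Proof.
move=> PQ [N [mN N0 PN]]; exists N; split=> // r /= nQ.
by apply: PN => /= Pr; apply: nQ; exact: PQ.
Qed.

Lemma ae_and (P Q : R -> Prop) : {ae mu, forall r, P r} ->
  {ae mu, forall r, Q r} -> {ae mu, forall r, P r /\ Q r}.
Proof.
move=> [N [mN N0 PN]] [M [mM M0 QM]]; exists (N `|` M); split.
- exact: measurableU.
- by rewrite measureU0.
- move=> r /= nPQ; have [Pr|/PN] := pselect (P r); last by left.
  by right; apply: QM => /= Qr; apply: nPQ.
Qed.

Lemma integrable_cstI c : mu.-integrable unitI (EFin \o cst c).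
Proof.
apply: measurable_bounded_integrable => //.
  by rewrite [X in (X < _)%E]lebesgue_unitI ltry.
by exists `|c|; split; [exact: num_real | move=> m cm r _ /=; exact: ltW].
Qed.

Lemma integrableDI f g : mu.-integrable unitI (EFin \o f) ->
  mu.-integrable unitI (EFin \o g) ->
  mu.-integrable unitI (EFin \o (fun r => f r + g r)).
Proof. by move=> jf jg; exact: (integrableD _ jf jg). Qed.

Lemma integrableBI f g : mu.-integrable unitI (EFin \o f) ->
  mu.-integrable unitI (EFin \o g) ->
  mu.-integrable unitI (EFin \o (fun r => f r - g r)).
Proof. by move=> jf jg; exact: (integrableB _ jf jg). Qed.

Lemma integrableZI a f : mu.-integrable unitI (EFin \o f) ->
  mu.-integrable unitI (EFin \o (fun r => a * f r)).
Proof. by move=> jf; exact: (integrableZl _ a jf). Qed.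

Definition sqint f : Prop :=
  measurable_fun unitI f /\ mu.-integrable unitI (EFin \o (fun r => f r ^+ 2)).

(** No arc length weight: a lower bound on the speed lets the weighted norms
control the unweighted ones. *)
Definition ip f g : R := \int[mu]_(r in unitI) (f r * g r).

Lemma le_sqint f h : measurable_fun unitI f ->
  mu.-integrable unitI (EFin \o h) ->
  (forall r, unitI r -> f r ^+ 2 <= h r) -> sqint f.
Proof.
move=> mf ih fh; split=> //; apply: (le_integrable _ _ _ ih) => //.
  by apply/measurable_EFinP; exact: measurable_funX.
move=> r Ir /=; rewrite lee_fin ger0_norm ?sqr_ge0//.
by rewrite (le_trans (fh r Ir))// ler_norm.
Qed.

Lemma integrable_ip f g : sqint f -> sqint g ->
  mu.-integrable unitI (EFin \o (fun r => f r * g r)).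
Proof.
move=> [mf if2] [mg ig2].
have ifg : mu.-integrable unitI (EFin \o (fun r => f r ^+ 2 + g r ^+ 2)).
  exact: integrableDI.
apply: (le_integrable _ _ _ ifg) => //.
  by apply/measurable_EFinP; exact: measurable_funM.
move=> r Ir /=; rewrite lee_fin [leRHS]ger0_norm ?addr_ge0 ?sqr_ge0//.
by rewrite ler_norml; nra.
Qed.

Lemma sqintD f g : sqint f -> sqint g -> sqint (fun r => f r + g r).
Proof.
move=> sf sg; have [mf if2] := sf; have [mg ig2] := sg.
apply: (@le_sqint _ (fun r => 2 * f r ^+ 2 + 2 * g r ^+ 2)).
- exact: measurable_funD.
- by apply: integrableDI; exact: integrableZI.
- by move=> r _; have := sqr_ge0 (f r - g r); lra.
Qed.

Lemma sqintZ a f : sqint f -> sqint (fun r => a * f r).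
Proof.
move=> [mf if2]; apply: (@le_sqint _ (fun r => a ^+ 2 * f r ^+ 2)).
- exact: measurable_funM.
- exact: integrableZI.
- by move=> r _; rewrite exprMn.
Qed.

Lemma sqintB f g : sqint f -> sqint g -> sqint (fun r => f r - g r).
Proof.
move=> sf sg.
have -> : (fun r => f r - g r) = (fun r => f r + -1 * g r).
  by apply/funext => r; rewrite mulN1r.
by apply: sqintD => //; exact: sqintZ.
Qed.

Lemma sqint_bounded c f : measurable_fun unitI f ->
  (forall r, unitI r -> `|f r| <= c) -> sqint f.
Proof.
move=> mf fc; apply: (@le_sqint _ (fun=> c ^+ 2)) => //.
  exact: integrable_cstI.
by move=> r Ir; have := fc r Ir; rewrite ler_norml; nra.
Qed.

Lemma sqint_cst c : sqint (fun=> c).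
Proof. by apply: (@sqint_bounded `|c|) => //; exact: measurable_cst. Qed.

Lemma sqint_integrable f : sqint f -> mu.-integrable unitI (EFin \o f).
Proof.
move=> sf; have := integrable_ip (sqint_cst 1) sf.
by congr (_.-integrable _ _); apply/funext => r /=; rewrite mul1r.
Qed.

Lemma ipC f g : ip f g = ip g f.
Proof. by apply: eq_Rintegral => r _; rewrite mulrC. Qed.

Lemma eq_ip f f' g g' : (forall r, unitI r -> f r * g r = f' r * g' r) ->
  ip f g = ip f' g'.
Proof. by move=> e; apply: eq_Rintegral => r /set_mem; exact: e. Qed.

Lemma ipDl f g h : sqint f -> sqint g -> sqint h ->
  ip (fun r => f r + g r) h = ip f h + ip g h.
Proof.
move=> sf sg sh; rewrite /ip -RintegralD//; [|exact: integrable_ip..].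
by apply: eq_Rintegral => r _; rewrite mulrDl.
Qed.

Lemma ipZl a f g : sqint f -> sqint g -> ip (fun r => a * f r) g = a * ip f g.
Proof.
move=> sf sg; rewrite /ip -RintegralZl//; last exact: integrable_ip.
by apply: eq_Rintegral => r _; rewrite mulrA.
Qed.

Lemma ipBl f g h : sqint f -> sqint g -> sqint h ->
  ip (fun r => f r - g r) h = ip f h - ip g h.
Proof.
move=> sf sg sh; rewrite /ip -RintegralB//; [|exact: integrable_ip..].
by apply: eq_Rintegral => r _; rewrite mulrBl.
Qed.

Lemma ipDr f g h : sqint f -> sqint g -> sqint h ->
  ip h (fun r => f r + g r) = ip h f + ip h g.
Proof. by move=> sf sg sh; rewrite ipC ipDl// !(ipC h). Qed.

Lemma ipZr a f g : sqint f -> sqint g -> ip g (fun r => a * f r) = a * ip g f.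
Proof. by move=> sf sg; rewrite ipC ipZl// (ipC g). Qed.

Lemma ipBr f g h : sqint f -> sqint g -> sqint h ->
  ip h (fun r => f r - g r) = ip h f - ip h g.
Proof. by move=> sf sg sh; rewrite ipC ipBl// !(ipC h). Qed.

Lemma ip_ge0 f : 0 <= ip f f.
Proof. by apply: Rintegral_ge0 => r _; rewrite -expr2 sqr_ge0. Qed.

(** The quadratic form a^2 <f, f> + 2 a b <f, g> + b^2 <g, g> is nonnegative. *)
Lemma cauchy_schwarz f g : sqint f -> sqint g ->
  `|ip f g| <= Num.sqrt (ip f f) * Num.sqrt (ip g g).
Proof.
move=> sf sg; rewrite -sqrtrM ?ip_ge0// -sqrtr_sqr ler_wsqrtr//.
have q a b : 0 <= a ^+ 2 * ip f f + 2 * a * b * ip f g + b ^+ 2 * ip g g.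
  have -> : a ^+ 2 * ip f f + 2 * a * b * ip f g + b ^+ 2 * ip g g =
    ip (fun r => a * f r + b * g r) (fun r => a * f r + b * g r).
    have sl : sqint (fun r => a * f r + b * g r) by apply: sqintD; exact: sqintZ.
    have sa := sqintZ a sf; have sb := sqintZ b sg.
    rewrite ipDl// !ipDr// !ipZl// !ipZr// (ipC g f); ring.
  exact: ip_ge0.
have := ip_ge0 f; have := ip_ge0 g.
set A := ip f f in q *; set B := ip f g in q *; set C := ip g g in q *.
move=> C0 A0.
have [Cp|Cn] := ltP 0 C.
  (* The minimizing choice of coefficients, up to the factor C. *)
  have := q C (- B).
  have -> : C ^+ 2 * A + 2 * C * - B * B + (- B) ^+ 2 * C = C * (A * C - B ^+ 2).
    by ring.
  by rewrite pmulr_rge0// subr_ge0.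
have Cz : C = 0 by lra.
(* Here the form is - (A + 2) * B^2, which forces B = 0. *)
have := q (- B) (A + 1); rewrite Cz !mulr0.
have : 0 <= A * B ^+ 2 by rewrite mulr_ge0 ?sqr_ge0.
by lra.
Qed.

End SquareIntegrable.
(* Closes the goal for either of the two convertible Borel structures on R. *)
#[export] Hint Extern 0 (measurable _) => exact: measurable_unitI : core.

Section L2Convergence.
Context {R : realType} {T : Type} {F : set_system T} {FF : ProperFilter F}.
Implicit Types (f g : R -> R).

(** Square integrability is only asked for eventually: difference quotients are
studied for small nonzero increments, where alone the curves are controlled. *)
Definition L2cvg (f_ : T -> R -> R) f : Prop :=
  [/\ \forall h \near F, sqint (f_ h), sqint f &
      ip (fun r => f_ h r - f r) (fun r => f_ h r - f r) @[h --> F] --> 0].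

Lemma L2cvg_cst f : sqint f -> L2cvg (fun=> f) f.
Proof.
move=> sf; split=> //; first by near=> h.
have -> : ip (fun r => f r - f r) (fun r => f r - f r) = 0.
  rewrite -[RHS](mul0r (ip f f)) -ipZl//.
  by apply: eq_ip => r _; rewrite subrr !mul0r.
exact: cvg_cst.
Unshelve. all: by end_near. Qed.

(** Joint continuity of the inner product: the error is
<df, dg> + <df, g> + <f, dg>, bounded by the Cauchy-Schwarz inequality. *)
Lemma L2cvg_ip (f_ g_ : T -> R -> R) f g : L2cvg f_ f -> L2cvg g_ g ->
  ip (f_ h) (g_ h) @[h --> F] --> ip f g.
Proof.
move=> [sf_ sf cf] [sg_ sg cg].
have sqrt_cvg0 (a : T -> R) : a h @[h --> F] --> 0 ->
    Num.sqrt (a h) @[h --> F] --> 0.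
  move=> ca; rewrite -[X in _ --> X]sqrtr0.
  by apply: continuous_cvg ca; exact: sqrt_continuous.
have rf := sqrt_cvg0 _ cf; have rg := sqrt_cvg0 _ cg.
set df := fun h r => f_ h r - f r in cf rf.
set dg := fun h r => g_ h r - g r in cg rg.
apply/subr_cvg0.
pose bound h := Num.sqrt (ip (df h) (df h)) * Num.sqrt (ip (dg h) (dg h)) +
  (Num.sqrt (ip (df h) (df h)) * Num.sqrt (ip g g) +
   Num.sqrt (ip f f) * Num.sqrt (ip (dg h) (dg h))).
have cbound : bound h @[h --> F] --> 0.
  have -> : 0 = 0 * 0 + (0 * Num.sqrt (ip g g) + Num.sqrt (ip f f) * 0) :> R.
    by rewrite !mulr0 !mul0r !addr0.
  apply: cvgD; first exact: cvgM.
  by apply: cvgD; [apply: cvgMr_tmp|apply: cvgMl_tmp].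
apply: norm_cvg0; apply: (squeeze_cvgr _ (cvg_cst 0) cbound).
near=> h; rewrite normr_ge0 /=.
have sfh : sqint (f_ h) by near: h.
have sgh : sqint (g_ h) by near: h.
have sdf : sqint (df h) by exact: sqintB.
have sdg : sqint (dg h) by exact: sqintB.
have -> : ip (f_ h) (g_ h) - ip f g =
    ip (df h) (dg h) + (ip (df h) g + ip f (dg h)).
  rewrite /df /dg ipBl// !ipBr// ipBl//; ring.
rewrite /bound (le_trans (ler_normD _ _))// lerD ?cauchy_schwarz//.
by rewrite (le_trans (ler_normD _ _))// lerD ?cauchy_schwarz.
Unshelve. all: by end_near. Qed.

End L2Convergence.

(** * Integration by parts for primitives *)

Section IntegrationByParts.
Context {R : realType}.
Local Notation mu := (@lebesgue_measure R).
Implicit Types f g u v : R -> R.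

Lemma integral_restrictZ (A : set R) a f h : measurable A ->
  mu.-integrable A (EFin \o f) ->
  (forall y, h y = ((fun y => a * f y) \_ A) y) ->
  (\int[mu]_y (h y)%:E = (a * \int[mu]_(y in A) f y)%:E)%E.
Proof.
move=> mA jf hE; rewrite EFinM /Rintegral fineK; last exact: integrable_fin_num.
rewrite -integralZl// [RHS]integral_mkcond; apply: eq_integral => y _.
by rewrite hE !patchE; case: ifP.
Qed.

Lemma integrable_sub01 (i : interval R) f : [set` i] `<=` unitI ->
  mu.-integrable unitI (EFin \o f) -> mu.-integrable [set` i] (EFin \o f).
Proof. by move=> s; apply: integrableS => //; exact: measurable_itv. Qed.

(** Both sides integrate f x * g y over the triangle x < y of the unit square. *)
Lemma fubini_triangle f g :
  mu.-integrable unitI (EFin \o f) -> mu.-integrable unitI (EFin \o g) ->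
  \int[mu]_(x in unitI) (f x * \int[mu]_(y in `]x, 1]) g y) =
  \int[mu]_(y in unitI) (g y * \int[mu]_(x in `[0, y[) f x).
Proof.
move=> jf jg.
have restr h : mu.-integrable unitI (EFin \o h) ->
    mu.-integrable setT (EFin \o (h \_ unitI)).
  move=> jh; rewrite -restrict_EFin; apply/(@integrable_mkcond _ _ _ mu _ _ _).1 => //; exact: measurable_itv.
pose F := f \_ unitI; pose G := g \_ unitI.
have jF : mu.-integrable setT (EFin \o F) by exact: restr.
have jG : mu.-integrable setT (EFin \o G) by exact: restr.
have mF : measurable_fun setT F by apply/measurable_EFinP; exact: (measurable_int mu).
have mG : measurable_fun setT G by apply/measurable_EFinP; exact: (measurable_int mu).
pose H (p : R * R) : R := F p.1 * G p.2.
pose K (p : R * R) : R := if p.1 < p.2 then H p else 0.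
have mH : measurable_fun setT H by apply: measurable_funM; apply: measurableT_comp.
have jH : (mu \x mu)%E.-integrable setT (EFin \o H).
  apply/integrable12ltyP; first exact/measurable_EFinP.
  have c0 : (0 <= \int[mu]_y `|G y|%:E)%E by exact: integral_ge0.
  have cG : (\int[mu]_y `|G y|%:E < +oo)%E by case/integrableP: jG.
  have cF : (\int[mu]_x `|F x|%:E < +oo)%E by case/integrableP: jF.
  have e x : (\int[mu]_y `|(EFin \o H) (x, y)| =
      `|F x|%:E * \int[mu]_y `|G y|%:E)%E.
    rewrite -ge0_integralZl//; last exact/measurable_EFinP/measurableT_comp.
    by apply: eq_integral => y _ /=; rewrite normrM EFinM.
  under eq_integral do rewrite e.
  rewrite ge0_integralZr//; last exact/measurable_EFinP/measurableT_comp.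
  apply: lte_mul_pinfty => //; first exact: integral_ge0.
  by rewrite ge0_fin_numE//; exact: integral_ge0.
have mK : measurable_fun setT K.
  by apply: measurable_fun_ifT => //; exact: measurable_fun_ltr.
have jK : (mu \x mu)%E.-integrable setT (EFin \o K).
  apply: (le_integrable _ _ _ jH) => //; first exact/measurable_EFinP.
  by move=> p _; rewrite /= lee_fin /K; case: ifP => //; rewrite normr0.
have innerx x : (\int[mu]_y (EFin \o K) (x, y) =
   (((fun x => f x * \int[mu]_(y in `]x, 1]) g y) \_ unitI) x)%:E)%E.
  rewrite patchE; case: ifPn => [/set_mem Ix|/negP nIx].
    apply: integral_restrictZ => //.
      apply: integrable_sub01 jg => y /=; rewrite /unitI /= !in_itv/=.
      by move: Ix; rewrite /unitI /= in_itv/= => /andP[x0 _] /andP[xy ->]; move/ltW: xy => xy;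
        rewrite (le_trans x0).
    move=> y; rewrite /K /H /F /G !patchE /= (mem_set Ix)//.
    move: Ix; rewrite /unitI /= in_itv/= => /andP[x0 x1].
    (* A restricted function takes the distinguished value of R, zero, outside. *)
    rewrite -![point]/(0 : R) !mem_setE !in_itv/=; case: ltP => //= xy.
    by rewrite (le_trans x0 (ltW xy))/=; case: ifP; rewrite // mulr0.
  rewrite -[point]/(0 : R) integral0_eq// => y _ /=; rewrite /K /H /F patchE/= memNset//.
    by rewrite mul0r if_same.
  by move=> Ix; apply: nIx; exact: mem_set.
have innery y : (\int[mu]_x (EFin \o K) (x, y) =
   (((fun y => g y * \int[mu]_(x in `[0, y[) f x) \_ unitI) y)%:E)%E.
  rewrite patchE; case: ifPn => [/set_mem Iy|/negP nIy].
    apply: integral_restrictZ => //.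
      apply: integrable_sub01 jf => x /=; rewrite /unitI /= !in_itv/=.
      by move: Iy; rewrite /unitI /= in_itv/= => /andP[_ y1] /andP[-> /ltW xy];
        rewrite (le_trans xy).
    move=> x; rewrite /K /H /F /G !patchE /= (mem_set Iy)//.
    move: Iy; rewrite /unitI /= in_itv/= => /andP[y0 y1].
    rewrite -![point]/(0 : R) !mem_setE !in_itv/=; case: ltP => //= xy; last by rewrite andbF.
    by rewrite (le_trans (ltW xy) y1)/= !andbT; case: ifP; rewrite ?mul0r// mulrC.
  rewrite -[point]/(0 : R) integral0_eq// => x _ /=; rewrite /K /H /G patchE/= memNset//.
    by rewrite mulr0 if_same.
  by move=> Iy; apply: nIy; exact: mem_set.
have := Fubini jK.
under eq_integral do rewrite innerx.
under [in RHS]eq_integral do rewrite innery.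
move=> e; rewrite Rintegral_mkcond [RHS]Rintegral_mkcond.
exact: (congr1 fine e).
Qed.

(** Absolute continuity without reference to the pointwise derivative. *)
Definition primitive u f : Prop :=
  forall r, r \in `[0, 1] -> u r = u 0 + \int[mu]_(q in `[0, r]) f q.

(** After subtracting the boundary values this is Fubini on the triangle; no
continuity of the derivatives is available. *)
Lemma ip_by_parts u u' v v' :
  sqint u -> sqint u' -> sqint v -> sqint v' ->
  primitive u u' -> primitive v v' ->
  ip u' v + ip u v' = u 1 * v 1 - u 0 * v 0.
Proof.
move=> su su' sv sv' pu pv.
have I1 : (1 : R) \in `[0, 1] by rewrite in_itv/= ler01 lexx.
have ju' := sqint_integrable su'; have jv' := sqint_integrable sv'.
have u1 : u 1 - u 0 = \int[mu]_(q in unitI) u' q by rewrite (pu 1)// addrC addKr.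
have v1 : v 1 - v 0 = \int[mu]_(q in unitI) v' q by rewrite (pv 1)// addrC addKr.
have ip1 f : ip f (fun=> 1) = \int[mu]_(q in unitI) f q.
  by apply: eq_Rintegral => r _; rewrite mulr1.
have key : ip u' (fun r => v 1 - v r) = ip v' (fun r => u r - u 0).
  have := fubini_triangle ju' jv'.
  set A := Rintegral _ _ _; set B := Rintegral _ _ _.
  have -> : A = ip u' (fun r => v 1 - v r).
    apply: eq_Rintegral => r /set_mem Ir; congr (_ * _).
    rewrite (pv 1)// (pv r)// opprD addrACA subrr add0r.
    have /andP[r0 r1] : 0 <= r <= 1 by move: Ir; rewrite /unitI/= in_itv.
    by rewrite Rintegral_itvB// bnd_simp.
  have -> : B = ip v' (fun r => u r - u 0).
    apply: eq_Rintegral => r /set_mem Ir; congr (_ * _).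
    rewrite (pu r)// [u 0 + _]addrC addrK Rintegral_itv_bndo_bndc//.
    apply: integrable_sub01 ju' => q.
    move: Ir; rewrite /unitI/= !in_itv/= => /andP[r0 r1] /andP[-> qr].
    by rewrite (le_trans (ltW qr)).
  by [].
have sc c : sqint (fun=> c : R) by exact: sqint_cst.
have ipc f c : sqint f -> ip f (fun=> c) = c * ip f (fun=> 1).
  by move=> sf; rewrite -ipZr//; apply: eq_ip => r _; rewrite !mulr1.
move: key; rewrite !ipBr// (ipc u')// (ipc v')// !ip1 -u1 -v1 (ipC u v'); lra.
Qed.

End IntegrationByParts.

(** * First-order expansion of the length *)

Section EuclideanLength.
Context {R : realType}.
Local Notation mu := (@lebesgue_measure R).
Implicit Types f g u v : R -> R.

Definition hypot (a b : R) : R := Num.sqrt (a * a + b * b).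

Lemma hypot_ge0 a b : 0 <= hypot a b.
Proof. exact: sqrtr_ge0. Qed.

Lemma hypot_sqr a b : hypot a b ^+ 2 = a * a + b * b.
Proof. by rewrite sqr_sqrtr// addr_ge0// -expr2 sqr_ge0. Qed.

Lemma hypot_eq0 a b : hypot a b = 0 -> a = 0 /\ b = 0.
Proof.
move=> h0; have := hypot_sqr a b; rewrite h0 expr0n/= => e.
by split; nra.
Qed.

Lemma normr_le_hypotl a b : `|a| <= hypot a b.
Proof. by rewrite -sqrtr_sqr ler_wsqrtr//; nra. Qed.

Lemma normr_le_hypotr a b : `|b| <= hypot a b.
Proof. by rewrite -sqrtr_sqr ler_wsqrtr//; nra. Qed.

Lemma hypot_cauchy a b a' b' : a * a' + b * b' <= hypot a b * hypot a' b'.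
Proof.
have pq : 0 <= hypot a b * hypot a' b' by rewrite mulr_ge0 ?hypot_ge0.
rewrite (le_trans (ler_norm _))// -[leRHS]ger0_norm// -ler_sqr ?nnegrE//.
rewrite !real_normK ?num_real// exprMn !hypot_sqr.
by have := sqr_ge0 (a * b' - b * a'); nra.
Qed.

(** Since [0^-1 = 0], the bound also covers the origin, where zero plays the
role of a subgradient. *)
Lemma hypot_ge_tangent a b a' b' :
  0 <= hypot a' b' - hypot a b -
       ((hypot a b)^-1 * a * (a' - a) + (hypot a b)^-1 * b * (b' - b)).
Proof.
have [p0|pN0] := eqVneq (hypot a b) 0.
  by rewrite p0 invr0 !mul0r addr0 !subr0 hypot_ge0.
have p0 : 0 < hypot a b by rewrite lt_neqAle eq_sym pN0 hypot_ge0.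
rewrite -(pmulr_rge0 _ p0).
have -> : hypot a b * (hypot a' b' - hypot a b -
       ((hypot a b)^-1 * a * (a' - a) + (hypot a b)^-1 * b * (b' - b))) =
    hypot a b * hypot a' b' - (a * a' + b * b') - (hypot a b ^+ 2 - (a * a + b * b)).
  by field.
by rewrite hypot_sqr subrr subr0 subr_ge0 hypot_cauchy.
Qed.

(** By p q <= (p^2 + q^2) / 2 with p and q the two norms. *)
Lemma hypot_le_parabola c a b a' b' : 0 < c -> c <= hypot a b ->
  hypot a' b' - hypot a b -
    ((hypot a b)^-1 * a * (a' - a) + (hypot a b)^-1 * b * (b' - b)) <=
  (2 * c)^-1 * ((a' - a) * (a' - a) + (b' - b) * (b' - b)).
Proof.
move=> c0 cp; have p0 : 0 < hypot a b by exact: lt_le_trans cp.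
set w := (a' - a) * (a' - a) + (b' - b) * (b' - b).
have w0 : 0 <= w by rewrite addr_ge0// -expr2 sqr_ge0.
apply: (@le_trans _ _ ((2 * hypot a b)^-1 * w)).
  have pp : 0 < 2 * hypot a b by rewrite mulr_gt0.
  rewrite -(ler_pM2l pp) mulrA mulfV ?gt_eqF// mul1r.
  have -> : 2 * hypot a b * (hypot a' b' - hypot a b -
       ((hypot a b)^-1 * a * (a' - a) + (hypot a b)^-1 * b * (b' - b))) =
    2 * (hypot a b * hypot a' b') - 2 * hypot a b ^+ 2
     - 2 * (a * (a' - a) + b * (b' - b)).
    by field; rewrite gt_eqF.
  have := sqr_ge0 (hypot a b - hypot a' b'); rewrite sqrrB !hypot_sqr /w.
  lra.
rewrite ler_wpM2r// lef_pV2 ?posrE ?mulr_gt0//.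
by rewrite ler_pM2l.
Qed.

Lemma measurable_hypot f g : measurable_fun unitI f -> measurable_fun unitI g ->
  measurable_fun unitI (fun r => hypot (f r) (g r)).
Proof.
move=> mf mg; apply: (@measurableT_comp _ _ _ _ _ _ (@Num.sqrt R)).
  by apply: continuous_measurable_fun; exact: sqrt_continuous.
by apply: measurable_funD; apply: measurable_funM.
Qed.

(** The inverse is a power with exponent -1, with the same value at zero. *)
Lemma measurable_inv_ge0 f : (forall r, 0 <= f r) -> measurable_fun unitI f ->
  measurable_fun unitI (fun r => (f r)^-1).
Proof.
move=> f0 mf; under eq_fun do rewrite -powR_inv1//.
exact: (measurableT_comp (measurable_powR (-1))).
Qed.

Lemma sqint_hypot f g : sqint f -> sqint g -> sqint (fun r => hypot (f r) (g r)).
Proof.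
move=> [mf if2] [mg ig2].
apply: (@le_sqint _ _ (fun r => f r ^+ 2 + g r ^+ 2)).
- exact: measurable_hypot.
- exact: integrableDI.
- by move=> r _; rewrite hypot_sqr !expr2.
Qed.

Lemma sqint_unit f g : sqint f -> sqint g ->
  sqint (fun r => (hypot (f r) (g r))^-1 * f r) /\
  sqint (fun r => (hypot (f r) (g r))^-1 * g r).
Proof.
move=> [mf _] [mg _]; have mh := measurable_hypot mf mg.
have mi := measurable_inv_ge0 (fun r => hypot_ge0 (f r) (g r)) mh.
have bound (a h : R) : `|a| <= h -> `|h^-1 * a| <= 1.
  move=> ah; have h0 : 0 <= h by exact: le_trans ah.
  have [->|hN0] := eqVneq h 0; first by rewrite invr0 mul0r normr0.
  have hp : 0 < h by rewrite lt_neqAle eq_sym hN0.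
  by rewrite normrM [`|h^-1|]gtr0_norm ?invr_gt0// ler_pdivrMl// mulr1.
by split; apply: (@sqint_bounded _ 1) => [|r _];
  [exact: measurable_funM|exact/bound/normr_le_hypotl|
   exact: measurable_funM|exact/bound/normr_le_hypotr].
Qed.

(** Integrated form of the tangent and parabola bounds; the parabola is a
majorant only almost everywhere, where the speed is at least c. *)
Lemma length_expansion c f g f' g' : 0 < c ->
  sqint f -> sqint g -> sqint f' -> sqint g' ->
  {ae mu, forall r, r \in `[0, 1] -> c <= hypot (f r) (g r)} ->
  `|\int[mu]_(r in unitI) hypot (f' r) (g' r)
    - \int[mu]_(r in unitI) hypot (f r) (g r)
    - (ip (fun r => (hypot (f r) (g r))^-1 * f r) (fun r => f' r - f r)
       + ip (fun r => (hypot (f r) (g r))^-1 * g r) (fun r => g' r - g r))|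
  <= (2 * c)^-1 * (ip (fun r => f' r - f r) (fun r => f' r - f r)
                   + ip (fun r => g' r - g r) (fun r => g' r - g r)).
Proof.
move=> c0 sf sg sf' sg' cfg.
have [se1 se2] := sqint_unit sf sg.
have sdf := sqintB sf' sf; have sdg := sqintB sg' sg.
have jh := sqint_integrable (sqint_hypot sf sg).
have jh' := sqint_integrable (sqint_hypot sf' sg').
have j1 := integrable_ip se1 sdf; have j2 := integrable_ip se2 sdg.
have k1 := integrable_ip sdf sdf; have k2 := integrable_ip sdg sdg.
have jdh := integrableBI jh' jh.
have j12 := integrableDI j1 j2.
have jD := integrableBI jdh j12.
have kD := integrableZI (2 * c)^-1 (integrableDI k1 k2).
set L := (X in `|X|); set B := leRHS.
pose D r := hypot (f' r) (g' r) - hypot (f r) (g r) -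
   ((hypot (f r) (g r))^-1 * f r * (f' r - f r) +
    (hypot (f r) (g r))^-1 * g r * (g' r - g r)).
pose Q r := (2 * c)^-1 * ((f' r - f r) * (f' r - f r) + (g' r - g r) * (g' r - g r)).
have -> : L = \int[mu]_(r in unitI) D r.
  rewrite /D /L /ip -RintegralB// -RintegralD// [RHS]RintegralB//.
have BE : \int[mu]_(r in unitI) Q r = B.
  by rewrite /B /ip -RintegralD// -RintegralZl//; exact: integrableDI.
apply: (@le_trans _ _ (\int[mu]_(r in unitI) Q r)); last by rewrite BE.
have D0 r : 0 <= D r by exact: hypot_ge_tangent.
rewrite ger0_norm; last by apply: Rintegral_ge0 => r _.
rewrite /Rintegral fine_le ?integrable_fin_num//.
apply: ae_ge0_le_integral => //.
- by move=> r _; rewrite lee_fin.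
- exact: measurable_int jD.
- move=> r _; rewrite lee_fin /Q mulr_ge0 ?invr_ge0 ?mulr_ge0 ?(ltW c0)//.
  by rewrite addr_ge0// -expr2 sqr_ge0.
- exact: measurable_int kD.
- apply: ae_imply cfg => r cr Ir; rewrite lee_fin; apply: hypot_le_parabola => //.
  exact: cr.
Qed.

End EuclideanLength.

(** * Weighted norms with a weight bounded below *)

Section WeightedNorms.
Context {R : realType}.
Local Notation mu := (@lebesgue_measure R).
Implicit Types (f g u v : R -> R) (G U : R -> R * R).

Import HBNNSimple.

(** The majorant need not be measurable: the integral of a nonnegative function
is a supremum over simple functions below it.  This matters because the
pointwise derivative of a difference is only almost everywhere the difference
of the derivatives, and the Borel sigma-algebra is not complete. *)
Lemma le_lower_integral (f g : R -> \bar R) : measurable_fun unitI f ->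
  (forall r, unitI r -> 0 <= f r)%E -> (forall r, unitI r -> 0 <= g r)%E ->
  {ae mu, forall r, unitI r -> f r <= g r}%E ->
  (\int[mu]_(r in unitI) f r <= \int[mu]_(r in unitI) g r)%E.
Proof.
move=> mf f0 g0 [N [mN N0 fgN]].
have -> : (\int[mu]_(r in unitI) f r = \int[mu]_(r in unitI `\` N) f r)%E.
  exact: ge0_negligible_integral.
rewrite integral_mkcond [leRHS]integral_mkcond.
rewrite !ge0_integralTE; last 2 first.
- by move=> r; rewrite patchE; case: ifPn => // /set_mem Ir; exact: g0.
- by move=> r; rewrite patchE; case: ifPn => // /set_mem [Ir _]; exact: f0.
apply: ereal_sup_le => _ /= [h hf <-]; exists h => // r.
apply: le_trans (hf r) _; rewrite !patchE.
case: ifPn => [/set_mem [Ir nNr]|_].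
  rewrite mem_set//; apply: contrapT => nfg; apply: nNr; apply: fgN => /= fg.
  by apply: nfg; exact: fg.
by case: ifPn => // /set_mem Ir; exact: g0.
Qed.

(** A weight bounded below by a positive constant can be dropped. *)
Lemma L2_sqint c G u : 0 < c -> {ae mu, forall r, r \in `[0, 1] -> c <= speed G r} ->
  L2 G u -> sqint u.
Proof.
move=> c0 cG [mu_ iu]; split=> //.
have mu2 : measurable_fun unitI (fun r => c * u r ^+ 2).
  by apply: measurable_funM => //; exact: measurable_funX.
suff : mu.-integrable unitI (EFin \o (fun r => c * u r ^+ 2)).
  move=> /(integrableZI c^-1); congr (_.-integrable _ _); apply/funext => r /=.
  by rewrite mulKf// gt_eqF.
apply/integrableP; split; first exact/measurable_EFinP.
apply: le_lt_trans iu; apply: le_lower_integral => //.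
- by apply: measurableT_comp => //; exact/measurable_EFinP.
- by move=> r _; rewrite lee_fin mulr_ge0 ?sqr_ge0 ?sqrtr_ge0.
- apply: ae_imply cG => r cr Ir; rewrite /= lee_fin ger0_norm; last first.
    by rewrite mulr_ge0 ?sqr_ge0// ltW.
  by rewrite mulrC real_normK ?num_real// ler_wpM2l ?sqr_ge0// cr.
Qed.

(** The g's are Borel representatives of U and of its derivative, whose pointwise
version may fail to be measurable. *)
Lemma le_H1norm2 c G U (g1 g2 g3 g4 : R -> R) : 0 < c ->
  {ae mu, forall r, r \in `[0, 1] -> c <= speed G r} ->
  sqint g1 -> sqint g2 -> sqint g3 -> sqint g4 ->
  {ae mu, forall r, r \in `[0, 1] -> [/\ cx U r = g1 r, cy U r = g2 r,
    derive1 (cx U) r = g3 r & derive1 (cy U) r = g4 r]} ->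
  ((c * (ip g1 g1 + ip g2 g2 + (ip g3 g3 + ip g4 g4)))%:E <= H1norm2 G U)%E.
Proof.
move=> c0 cG s1 s2 s3 s4 Ug.
have j1 := integrable_ip s1 s1; have j2 := integrable_ip s2 s2.
have j3 := integrable_ip s3 s3; have j4 := integrable_ip s4 s4.
have j := integrableZI c (integrableDI (integrableDI j1 j2) (integrableDI j3 j4)).
have -> : c * (ip g1 g1 + ip g2 g2 + (ip g3 g3 + ip g4 g4)) =
    \int[mu]_(r in unitI) (c * (g1 r * g1 r + g2 r * g2 r +
                              (g3 r * g3 r + g4 r * g4 r))).
  rewrite /ip -!RintegralD//; try exact: integrableDI.
  by rewrite -RintegralZl//; do ?apply: integrableDI.
rewrite /Rintegral fineK; last exact: integrable_fin_num j.
apply: le_lower_integral => //.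
- exact: measurable_int j.
- move=> r _; rewrite lee_fin mulr_ge0 ?(ltW c0)//.
  by rewrite !addr_ge0// -expr2 sqr_ge0.
- move=> r _; rewrite lee_fin mulr_ge0 ?sqrtr_ge0//.
  by rewrite /dot !addr_ge0// -expr2 sqr_ge0.
- apply: ae_imply (ae_and cG Ug) => r [cr Ur] Ir; rewrite lee_fin.
  have [e1 e2 e3 e4] := Ur Ir.
  have -> : dot (U r) (U r) + dot (dpar U r) (dpar U r) =
      g1 r * g1 r + g2 r * g2 r + (g3 r * g3 r + g4 r * g4 r).
    by rewrite /dot /dpar /= e3 e4 -e1 -e2.
  rewrite mulrC ler_wpM2l ?cr//.
  by rewrite !addr_ge0// -expr2 sqr_ge0.
Qed.

Lemma squeeze_fin_cvg0 {T : Type} (F : set_system T) {FF : Filter F} c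
    (a : T -> R) (H : T -> \bar R) : 0 < c ->
  (\forall h \near F, 0 <= a h /\ ((c * a h)%:E <= H h)%E) ->
  H h @[h --> F] --> 0%E -> a h @[h --> F] --> 0.
Proof.
move=> c0 aH H0.
have ca : (c * a h)%:E @[h --> F] --> 0%E.
  apply: (@squeeze_cvge _ _ _ _ (cst 0%E) _ H _ 0%E _ H0); last exact: cvg_cst.
  by apply: filterS aH => h [a0 ->]; rewrite andbT lee_fin mulr_ge0// ltW.
have := @cvgMl_tmp _ _ F _ _ c^-1 _ (fine_cvg ca).
have -> : (fun h => c^-1 * (fine \o (fun h => (c * a h)%:E)) h) = a.
  by apply/funext => h /=; rewrite mulKf// gt_eqF.
by rewrite mulr0; apply.
Qed.

End WeightedNorms.

(** * Differentiating inner products and lengths of families *)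

Section Calculus.
Context {R : realType}.
Local Notation mu := (@lebesgue_measure R).
Implicit Types (f g u v w : R -> R).

Definition difference_quotient (f_ : R -> R -> R) f : R -> R -> R :=
  fun h r => h^-1 * (f_ h r - f r).

Lemma difference_quotientE (f_ : R -> R -> R) f h : h != 0 ->
  f_ h = (fun r => f r + h * difference_quotient f_ f h r).
Proof.
by move=> h0; apply/funext => r; rewrite /difference_quotient mulVKf// addrC subrK.
Qed.

Lemma cvg_dnbhs_id (a : R) : h @[h --> a^'] --> a.
Proof. by apply: cvg_within_filter; exact: cvg_id. Qed.

(** With p and q the difference quotients, that of <f, g> is
<p, g> + <f, q> + h <p, q>, and each term converges. *)
Lemma ip_differentiable (f_ g_ : R -> R -> R) f g v w : sqint f -> sqint g ->
  L2cvg (F := 0^') (difference_quotient f_ f) v ->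
  L2cvg (F := 0^') (difference_quotient g_ g) w ->
  h^-1 * (ip (f_ h) (g_ h) - ip f g) @[h --> 0^'] --> ip v g + ip f w.
Proof.
move=> sf sg cf cg; have [nf _ _] := cf; have [ng _ _] := cg.
pose p := difference_quotient f_ f; pose q := difference_quotient g_ g.
have lim : ip (p h) g + ip f (q h) + h * ip (p h) (q h) @[h --> 0^'] -->
    ip v g + ip f w + 0 * ip v w.
  apply: cvgD; first by apply: cvgD; apply: L2cvg_ip => //; exact: L2cvg_cst.
  by apply: cvgM; [exact: cvg_dnbhs_id|exact: L2cvg_ip].
rewrite mul0r addr0 in lim; apply: cvg_trans lim; apply: near_eq_cvg.
near=> h.
have h0 : h != 0 by near: h; exact: nbhs_dnbhs_neq.
have sp : sqint (p h) by near: h; exact: nf.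
have sq : sqint (q h) by near: h; exact: ng.
have shp := sqintZ h sp; have shq := sqintZ h sq.
rewrite (difference_quotientE f_ f h0) (difference_quotientE g_ g h0).
rewrite -/(p h) -/(q h).
(* Abstracting the quotients keeps the bilinearity rules out of them. *)
move: (p h) (q h) sp sq shp shq => P Q sp sq shp shq.
rewrite ipDl//; last exact: sqintD.
by rewrite !ipDr// !ipZl// ?ipZr//; field.
Unshelve. all: by end_near. Qed.

(** The error of the first-order expansion is of order h^2, since the difference
quotients converge, hence are bounded, in L2. *)
Lemma length_differentiable c (f_ g_ : R -> R -> R) f g v w : 0 < c ->
  {ae mu, forall r, r \in `[0, 1] -> c <= hypot (f r) (g r)} ->
  sqint f -> sqint g ->
  L2cvg (F := 0^') (difference_quotient f_ f) v ->
  L2cvg (F := 0^') (difference_quotient g_ g) w ->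
  h^-1 * (\int[mu]_(r in unitI) hypot (f_ h r) (g_ h r)
          - \int[mu]_(r in unitI) hypot (f r) (g r)) @[h --> 0^'] -->
  ip (fun r => (hypot (f r) (g r))^-1 * f r) v +
  ip (fun r => (hypot (f r) (g r))^-1 * g r) w.
Proof.
move=> c0 cfg sf sg cf cg; have [nf _ _] := cf; have [ng _ _] := cg.
have [se1 se2] := sqint_unit sf sg.
set e1 := fun r => _ * f r in se1 *; set e2 := fun r => _ * g r in se2 *.
pose p := difference_quotient f_ f; pose q := difference_quotient g_ g.
have lin : ip e1 (p h) + ip e2 (q h) @[h --> 0^'] --> ip e1 v + ip e2 w.
  by apply: cvgD; apply: L2cvg_ip => //; exact: L2cvg_cst.
have err : `|h| * ((2 * c)^-1 * (ip (p h) (p h) + ip (q h) (q h))) @[h --> 0^'] -->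
    `|0 : R| * ((2 * c)^-1 * (ip v v + ip w w)).
  apply: cvgM; first by apply: cvg_norm; exact: cvg_dnbhs_id.
  by apply: cvgMl_tmp; apply: cvgD; exact: L2cvg_ip.
rewrite normr0 mul0r in err.
rewrite -[X in _ --> X]addr0.
pose D h := h^-1 * (\int[mu]_(r in unitI) hypot (f_ h r) (g_ h r)
          - \int[mu]_(r in unitI) hypot (f r) (g r)) - (ip e1 (p h) + ip e2 (q h)).
have D0 : D h @[h --> 0^'] --> 0.
  apply/norm_cvg0P.
  apply: (@squeeze_cvgr _ _ _ _ (cst 0) _ _ _ 0 _ err); last exact: cvg_cst.
  near=> h; rewrite normr_ge0 /=.
  have h0 : h != 0 by near: h; exact: nbhs_dnbhs_neq.
  have sp : sqint (p h) by near: h; exact: nf.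
  have sq : sqint (q h) by near: h; exact: ng.
  have sfh : sqint (f_ h).
    by rewrite (difference_quotientE f_ f h0); apply/sqintD/sqintZ.
  have sgh : sqint (g_ h).
    by rewrite (difference_quotientE g_ g h0); apply/sqintD/sqintZ.
  have := length_expansion c0 sf sg sfh sgh cfg.
  have -> : (fun r => f_ h r - f r) = (fun r => h * p h r).
    by apply/funext => r; rewrite /p /difference_quotient mulVKf.
  have -> : (fun r => g_ h r - g r) = (fun r => h * q h r).
    by apply/funext => r; rewrite /q /difference_quotient mulVKf.
  rewrite -/e1 -/e2 {}/D; move: (p h) (q h) sp sq => P Q sp sq.
  have shp := sqintZ h sp; have shq := sqintZ h sq.
  rewrite !ipZr// !ipZl//.
  set d := (X in `|X - _| <= _ -> _) => le.
  have -> : h^-1 * d - (ip e1 P + ip e2 Q) =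
      h^-1 * (d - (h * ip e1 P + h * ip e2 Q)) by field.
  rewrite normrM normfV ler_pdivrMl ?normr_gt0//.
  apply: le_trans le _; rewrite [leRHS]mulrA -[`|h| * `|h|]expr2 real_normK ?num_real//.
  by rewrite le_eqVlt; apply/orP; left; apply/eqP; ring.
apply: cvg_trans (cvgD lin D0); apply: near_eq_cvg; near=> h.
by rewrite /D addrC subrK.
Unshelve. all: by end_near. Qed.

Lemma length_continuous {T : Type} (F : set_system T) {FF : ProperFilter F} c
    (f_ g_ : T -> R -> R) f g : 0 < c ->
  {ae mu, forall r, r \in `[0, 1] -> c <= hypot (f r) (g r)} ->
  L2cvg (F := F) f_ f -> L2cvg (F := F) g_ g ->
  \int[mu]_(r in unitI) hypot (f_ h r) (g_ h r) @[h --> F] -->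
  \int[mu]_(r in unitI) hypot (f r) (g r).
Proof.
move=> c0 cfg cf cg; have [nf sf ef] := cf; have [ng sg eg] := cg.
have [se1 se2] := sqint_unit sf sg.
set e1 := fun r => _ * f r in se1 *; set e2 := fun r => _ * g r in se2 *.
have lin : (ip e1 (f_ h) - ip e1 f) + (ip e2 (g_ h) - ip e2 g) @[h --> F] --> 0.
  rewrite -[X in _ --> X]addr0.
  by apply: cvgD; apply/subr_cvg0; apply: L2cvg_ip => //; exact: L2cvg_cst.
have err : (2 * c)^-1 * (ip (fun r => f_ h r - f r) (fun r => f_ h r - f r)
    + ip (fun r => g_ h r - g r) (fun r => g_ h r - g r)) @[h --> F] --> 0.
  have -> : 0 = (2 * c)^-1 * (0 + 0) :> R by rewrite addr0 mulr0.
  by apply: cvgMl_tmp; exact: cvgD.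
pose D h := \int[mu]_(r in unitI) hypot (f_ h r) (g_ h r)
          - \int[mu]_(r in unitI) hypot (f r) (g r) -
   ((ip e1 (f_ h) - ip e1 f) + (ip e2 (g_ h) - ip e2 g)).
have D0 : D h @[h --> F] --> 0.
  apply/norm_cvg0P.
  apply: (@squeeze_cvgr _ _ _ _ (cst 0) _ _ _ 0 _ err); last exact: cvg_cst.
  near=> h; rewrite normr_ge0 /=.
  have sfh : sqint (f_ h) by near: h; exact: nf.
  have sgh : sqint (g_ h) by near: h; exact: ng.
  have := length_expansion c0 sf sg sfh sgh cfg.
  by rewrite -/e1 -/e2 (ipBr sfh sf se1) (ipBr sgh sg se2).
apply/subr_cvg0; rewrite -[X in _ --> X]addr0.
apply: cvg_trans (cvgD D0 lin); apply: near_eq_cvg; near=> h.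
by rewrite /D /= subrK.
Unshelve. all: by end_near. Qed.

End Calculus.

(** * Curves depending on time *)

Section CurvesInTime.
Context {R : realType}.
Local Notation mu := (@lebesgue_measure R).
Implicit Types (f g u v : R -> R) (G U V : R -> R * R) (X : R -> R -> R * R).

(** Common source of the convergence at positive times (for difference
quotients) and at the initial time (for the curves themselves). *)
Lemma H1norm2_L2cvg {T : Type} (F : set_system T) {FF : ProperFilter F} G
    (U : T -> R -> R * R) (p1 p2 p3 p4 : T -> R -> R) (v1 v2 v3 v4 : R -> R) :
  regular G -> sqint v1 -> sqint v2 -> sqint v3 -> sqint v4 ->
  (\forall h \near F,
    [/\ sqint (p1 h), sqint (p2 h), sqint (p3 h), sqint (p4 h) &
    {ae mu, forall r, r \in `[0, 1] ->
      [/\ cx (U h) r = p1 h r - v1 r, cy (U h) r = p2 h r - v2 r,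
          derive1 (cx (U h)) r = p3 h r - v3 r &
          derive1 (cy (U h)) r = p4 h r - v4 r]}]) ->
  H1norm2 G (U h) @[h --> F] --> 0%E ->
  [/\ L2cvg (F := F) p1 v1, L2cvg (F := F) p2 v2,
      L2cvg (F := F) p3 v3 & L2cvg (F := F) p4 v4].
Proof.
move=> [c c0 cG] s1 s2 s3 s4 near_p U0.
pose n (p : T -> R -> R) v h := ip (fun r => p h r - v r) (fun r => p h r - v r).
have n_ge0 p v h : 0 <= n p v h by exact: ip_ge0.
have bound : \forall h \near F, ((c * (n p1 v1 h + n p2 v2 h +
    (n p3 v3 h + n p4 v4 h)))%:E <= H1norm2 G (U h))%E.
  apply: filterS near_p => h [q1 q2 q3 q4 Ueq].
  by apply: (le_H1norm2 c0 cG) Ueq; exact: sqintB.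
have cvg0 (m : T -> R) : (forall h, 0 <= m h <= n p1 v1 h + n p2 v2 h +
    (n p3 v3 h + n p4 v4 h)) -> m h @[h --> F] --> 0.
  move=> mle; apply: (squeeze_fin_cvg0 c0 _ U0).
  apply: filterS bound => h; have /andP[m0 mn] := mle h.
  move=> bh; split=> //; apply: le_trans bh.
  by rewrite lee_fin ler_wpM2l// ltW.
split; split=> //; try by apply: filterS near_p => h [].
- by apply: cvg0 => h; rewrite n_ge0/= -addrA lerDl !addr_ge0.
- by apply: cvg0 => h; rewrite n_ge0/= -addrA addrCA lerDl !addr_ge0.
- by apply: cvg0 => h; rewrite n_ge0/= addrCA lerDl !addr_ge0.
- by apply: cvg0 => h; rewrite n_ge0/= addrA lerDr !addr_ge0.
Qed.

Lemma ae_closed01 (P : R -> Prop) :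
  {ae mu, forall r, r \in `]0, 1[ -> P r} -> {ae mu, forall r, r \in `[0, 1] -> P r}.
Proof.
have point a : {ae mu, forall r : R, r != a}.
  exists [set a]; split=> //; first exact: lebesgue_measure_set1.
  by move=> r /= /negP; rewrite negbK => /eqP.
move=> aeP; apply: ae_imply (ae_and aeP (ae_and (point 0) (point 1))).
move=> r [Pr [r0 r1]]; rewrite in_itv/= => /andP[ge0 le1]; apply: Pr.
by rewrite in_itv/= !lt_neqAle ge0 le1 r1 eq_sym r0.
Qed.

Lemma H1_sqint G u : regular G -> H1 G u ->
  [/\ sqint u, sqint (derive1 u) & primitive u (derive1 u)].
Proof.
by move=> [c c0 cG] [[_ _ up] u2 u2']; split=> //; exact: (L2_sqint c0 cG).
Qed.

Lemma derive1_lincomb k u v w r :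
  derivable u r 1 -> derivable v r 1 -> derivable w r 1 ->
  derive1 (fun q => k * (u q - v q) - w q) r =
  k * (derive1 u r - derive1 v r) - derive1 w r.
Proof.
move=> /derivableP du /derivableP dv /derivableP dw; rewrite !derive1E.
exact: (@derive_val _ _ _ _ _ _ _
  (is_deriveB (is_deriveZ k (is_deriveB du dv)) dw)).
Qed.

Lemma ae_derive1_lincomb k G1 G2 G3 u v w : H1 G1 u -> H1 G2 v -> H1 G3 w ->
  {ae mu, forall r, r \in `[0, 1] ->
    derive1 (fun q => k * (u q - v q) - w q) r =
    k * (derive1 u r - derive1 v r) - derive1 w r}.
Proof.
move=> [[du _ _] _ _] [[dv _ _] _ _] [[dw _ _] _ _]; apply: ae_closed01.
apply: ae_imply (ae_and du (ae_and dv dw)) => r [hu [hv hw]] r01.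
by apply: derive1_lincomb; [exact: hu|exact: hv|exact: hw].
Qed.

Lemma ae_derive1B G1 G2 u v : H1 G1 u -> H1 G2 v ->
  {ae mu, forall r, r \in `[0, 1] ->
    derive1 (fun q => u q - v q) r = derive1 u r - derive1 v r}.
Proof.
move=> [[du _ _] _ _] [[dv _ _] _ _]; apply: ae_closed01.
apply: ae_imply (ae_and du dv) => r [hu hv] r01.
have /derivableP {}hu := hu r01; have /derivableP {}hv := hv r01.
by rewrite !derive1E; exact: (@derive_val _ _ _ _ _ _ _ (is_deriveB hu hv)).
Qed.

(** What is known of the evolving curve at every time, including the initial one,
where nondegeneracy comes from the arc length parameterization. *)
Definition admissible G : Prop := regular G /\ XX G G.

Lemma admissible_sqint G : admissible G ->
  [/\ sqint (cx G), sqint (cy G), sqint (derive1 (cx G)) & sqint (derive1 (cy G))].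
Proof.
move=> [rG [xG [yG _ _]]].
by have [? ? _] := H1_sqint rG xG; have [? ? _] := H1_sqint rG yG.
Qed.

Lemma sqint_difference_quotient (f_ : R -> R -> R) f h : sqint (f_ h) -> sqint f ->
  sqint (difference_quotient f_ f h).
Proof. by move=> s1 s2; apply: sqintZ; exact: sqintB. Qed.

Lemma time_differentiable_L2cvg X t : 0 < t ->
  (forall s, 0 < s -> admissible (X s)) -> time_differentiable X t ->
  [/\ L2cvg (F := 0^') (difference_quotient (fun h => cx (X (t + h))) (cx (X t)))
        (cx (dtime X t)),
      L2cvg (F := 0^') (difference_quotient (fun h => cy (X (t + h))) (cy (X t)))
        (cy (dtime X t)),
      L2cvg (F := 0^') (difference_quotient (fun h => derive1 (cx (X (t + h))))
        (derive1 (cx (X t)))) (derive1 (cx (dtime X t))) &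
      L2cvg (F := 0^') (difference_quotient (fun h => derive1 (cy (X (t + h))))
        (derive1 (cy (X t)))) (derive1 (cy (dtime X t)))].
Proof.
move=> t0 aX [_ [xV [yV _ _]] tX].
have at_ := aX t t0; have [rt [xt [yt _ _]]] := at_.
have [sx sy sx' sy'] := admissible_sqint at_.
have [sVx sVx' _] := H1_sqint rt xV; have [sVy sVy' _] := H1_sqint rt yV.
apply: H1norm2_L2cvg tX => //.
have : \forall h \near (0 : R), - t < h by apply: lt_nbhsr; rewrite oppr_lt0.
move=> /nbhs_dnbhs; apply: filterS => h th.
have ah : admissible (X (t + h)) by apply: aX; rewrite addrC -ltrBlDr sub0r.
have [zx zy zx' zy'] := admissible_sqint ah.
have [_ [xh [yh _ _]]] := ah.
split; [exact: sqint_difference_quotient..|].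
apply: ae_imply (ae_and (ae_derive1_lincomb h^-1 xh xt xV)
  (ae_derive1_lincomb h^-1 yh yt yV)) => r [ex ey] r01.
by split=> //; [exact: ex|exact: ey].
Qed.

Lemma initially_continuous_L2cvg X :
  (forall s, 0 <= s -> admissible (X s)) -> initially_continuous X ->
  [/\ L2cvg (F := 0^'+) (fun t => cx (X t)) (cx (X 0)),
      L2cvg (F := 0^'+) (fun t => cy (X t)) (cy (X 0)),
      L2cvg (F := 0^'+) (fun t => derive1 (cx (X t))) (derive1 (cx (X 0))) &
      L2cvg (F := 0^'+) (fun t => derive1 (cy (X t))) (derive1 (cy (X 0)))].
Proof.
move=> aX cX; have a0 := aX 0 (lexx 0).
have [sx sy sx' sy'] := admissible_sqint a0.
have [r0 [x0 [y0 _ _]]] := a0.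
apply: H1norm2_L2cvg cX => //.
near=> t; have t0 : 0 <= t by [].
have [zx zy zx' zy'] := admissible_sqint (aX t t0).
have [_ [xt [yt _ _]]] := aX t t0.
split=> //.
apply: ae_imply (ae_and (ae_derive1B xt x0) (ae_derive1B yt y0)) => r [ex ey] r01.
by split=> //; [exact: ex|exact: ey].
Unshelve. all: by end_near. Qed.

End CurvesInTime.

(** * Reparameterization of the initial curve *)

Section InitialCurve.
Context {R : realType}.
Local Notation mu := (@lebesgue_measure R).
Implicit Types (f F : R -> R).

Lemma preimage_scale_itv (L a b : R) (b0 b1 : bool) : 0 < L ->
  ( *%R L) @^-1` [set` Interval (BSide b0 (L * a)) (BSide b1 (L * b))] =
  [set` Interval (BSide b0 a) (BSide b1 b)].
Proof.
by move=> L0; apply/seteqP; split=> x /=; rewrite !itv_boundlr/=;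
  case: b0; case: b1; rewrite ?bnd_simp /= ?ltr_pM2l ?ler_pM2l.
Qed.

Let measurable_scale (L : R) :
  measurable_fun setT ( *%R L : measurableTypeR R -> measurableTypeR R).
Proof. exact: mulrl_measurable. Qed.

(** The measure L * mu (L^-1 * A), built from the pushforward of mu under the
dilation; it is identified below with mu itself. The measure structure of a
pushforward depends on a proof of measurability, hence the explicit
application. *)
Definition scaled_measure (L : R) (L0 : 0 < L) :
    {measure set (measurableTypeR R) -> \bar R} :=
  mscale (NngNum (ltW L0))
    (measure_function_pushforward__canonical__measure_function_Measure mu
       (@measurable_scale L)).

(** By uniqueness, it is enough to compare both measures on intervals. *)
Lemma lebesgue_measure_scale (L : R) (L0 : 0 < L)
    (A : set (measurableTypeR R)) : measurable A -> mu A = scaled_measure L0 A.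
Proof.
apply: lebesgue_measure_unique => _ /ocitvP[->|[[a b] /= ab ->]].
  by rewrite !measure0.
rewrite /= /mscale /= /pushforward.
have -> : `]a, b]%classic = `]L * (L^-1 * a), L * (L^-1 * b)]%classic.
  by rewrite !mulVKf ?gt_eqF.
rewrite preimage_scale_itv// !lebesgue_measure_itv/= !lte_fin.
rewrite !mulVKf ?gt_eqF// ltr_pM2l ?invr_gt0//.
case: ifP => _; last by rewrite mule0.
by rewrite -!EFinB -EFinM -mulrBr mulVKf// gt_eqF.
Qed.

Lemma ae_scale (L : R) (P : R -> Prop) : 0 < L ->
  {ae mu, forall s, P s} -> {ae mu, forall r, P (L * r)}.
Proof.
move=> L0 [N [mN N0 PN]]; exists (( *%R L) @^-1` N); split.
- by rewrite -[X in measurable X]setTI; exact: measurable_scale.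
- have := lebesgue_measure_scale L0 mN.
  rewrite [LHS]N0 /= /mscale/= /pushforward => /esym/eqP.
  by rewrite mule_eq0 eqe gt_eqF//= => /eqP.
- by move=> r /= nP; apply: PN.
Qed.

Lemma ge0_integral_scale (L : R) (D : set (measurableTypeR R)) (f : R -> \bar R) :
  0 < L -> measurable D -> measurable_fun D f -> (forall s, D s -> 0 <= f s)%E ->
  (\int[mu]_(s in D) f s = L%:E * \int[mu]_(r in ( *%R L) @^-1` D) f (L * r)%R)%E.
Proof.
move=> L0 mD mf f0.
rewrite (@eq_measure_integral _ _ _ D (scaled_measure L0)); last first.
  by move=> A mA _; exact: lebesgue_measure_scale.
rewrite ge0_integral_mscale//; congr (_ * _)%E.
by rewrite ge0_integral_pushforward// => s /set_mem; exact: f0.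
Qed.

(** The integrand f is prescribed on the open interval only, which is where the
derivative of a reparameterized function is controlled. *)
Lemma Rintegral_scale (L : R) f F : 0 < L ->
  mu.-integrable unitI (EFin \o F) ->
  (forall r, r \in `]0, 1[ -> f (L * r) = F r) ->
  \int[mu]_(s in `[0, L]) f s = L * \int[mu]_(r in unitI) F r.
Proof.
move=> L0 jF fF.
have sub01 : `]0 : R, 1[ `<=` unitI by exact: subset_itv_oo_cc.
have jF' : mu.-integrable `]0, 1[ (EFin \o F) by exact: integrable_sub01 jF.
have mF' : measurable_fun (`]0, 1[ : set R) F by apply/measurable_EFinP; exact: (measurable_int mu).
pose h s := F (L^-1 * s).
have hF r : h (L * r) = F r by rewrite /h mulKf// gt_eqF.
have fh s : s \in `]0, L[ -> f s = h s.
  rewrite in_itv/= => /andP[s0 sL]; rewrite -[s](mulVKf (lt0r_neq0 L0)) hF fF//.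
  by rewrite in_itv/= ltr_pdivrMl// mulr1 sL mulr_gt0// invr_gt0.
have mh : measurable_fun (`]0, L[ : set R) h.
  apply: (measurable_comp _ _ mF'); first exact: measurable_itv.
    move=> _ [s + <-]; rewrite /= !in_itv/= => /andP[s0 sL].
    by rewrite ltr_pdivrMl// mulr1 sL mulr_gt0// invr_gt0.
  by apply: measurable_funTS; exact: mulrl_measurable.
have mf : measurable_fun (`]0, L[ : set R) f.
  by apply: eq_measurable_fun mh => s /set_mem sI; rewrite fh.
have jh : (\int[mu]_(s in `]0%R, L[) (h s)%:E = L%:E * \int[mu]_(r in `]0%R, 1%R[) (F r)%:E)%E.
  have pre : ( *%R L) @^-1` `]0, L[%classic = `]0, 1[%classic.
    by have := preimage_scale_itv 0 1 false true L0; rewrite mulr0 mulr1.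
  have part (P : R -> \bar R) : measurable_fun (`]0, L[ : set R) P ->
      (forall s, 0 <= P s)%E ->
      (\int[mu]_(s in `]0%R, L[) P s = L%:E * \int[mu]_(r in `]0%R, 1%R[) P (L * r)%R)%E.
    by move=> mP P0; rewrite -pre; apply: ge0_integral_scale => //; exact: measurable_itv.
  have pos : (\int[mu]_(r in `]0%R, 1%R[) (fun r => (F r)%:E)^\+ r)%E \is a fin_num.
    by apply: integrable_pos_fin_num jF'; exact: measurable_itv.
  rewrite integralE [in RHS]integralE muleBr//; last first.
    by rewrite fin_num_adde_defr.
  have mhE : measurable_fun (`]0, L[ : set R) (EFin \o h) by exact/measurable_EFinP.
  rewrite (part _ (measurable_funepos mhE))// (part _ (measurable_funeneg mhE))//.
  by congr (_ * _ - _ * _)%E; apply: eq_integral => r _; rewrite ?funeposE ?funenegE /= hF.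
have fL : (\int[mu]_(s in `[0%R, L]) (f s)%:E = \int[mu]_(s in `]0%R, L[) (h s)%:E)%E.
  rewrite (@integral_itv_bndoo _ _ _ _ true false); last exact/measurable_EFinP.
  by apply: eq_integral => s /set_mem sI; rewrite fh.
have FI : (\int[mu]_(s in unitI) (F s)%:E = \int[mu]_(s in `]0%R, 1%R[) (F s)%:E)%E.
  by rewrite /unitI (@integral_itv_bndoo _ _ _ _ true false)//; exact/measurable_EFinP.
transitivity (fine (L%:E * \int[mu]_(s in unitI) (F s)%:E)%E); last first.
  by rewrite fineM//; exact: integrable_fin_num jF.
by rewrite FI -jh -fL.
Qed.

(** Valid without differentiability: both sides then take the default value 0 of
a divergent limit. *)
Lemma derive1_scale (L : R) f r : L != 0 ->
  derive1 (fun q => f (L * q)) r = L * derive1 f (L * r).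
Proof.
move=> L0.
have scale (g : R -> R) (k q : R) : derivable g (k * q) 1 ->
    is_derive q 1 (fun q => g (k * q)) ('D_1 g (k * q) * k).
  move=> /derivableP dg; apply: (is_derive1_comp dg).
  by have := is_deriveZ k (is_derive_id q 1); rewrite /GRing.scale/= mulr1.
have [df|ndf] := pselect (derivable f (L * r) 1).
  by rewrite !derive1E mulrC; exact: (@derive_val _ _ _ _ _ _ _ (scale f L r df)).
have ndg : ~ derivable (fun q => f (L * q)) r 1.
  move=> dg; apply: ndf.
  have dg' : derivable (fun q => f (L * q)) (L^-1 * (L * r)) 1 by rewrite mulKf.
  have [+ _] := scale (fun q => f (L * q)) L^-1 (L * r) dg'.
  by have -> : (fun q => f (L * (L^-1 * q))) = f
    by apply/funext => q; rewrite mulVKf.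
have D0 (g : R -> R) q : ~ derivable g q 1 -> 'D_1 g q = 0.
  by move=> ndgq; exact: (dvgP ndgq).
by rewrite !derive1E (D0 _ _ ndf) (D0 _ _ ndg) mulr0.
Qed.

End InitialCurve.

(** * Area, energy and their test functions *)

Section Evolution.
Context {R : realType}.
Local Notation mu := (@lebesgue_measure R).
Implicit Types (f g u v d : R -> R) (G U V : R -> R * R) (X : R -> R -> R * R).

Lemma speed_eq0 G r : speed G r = 0 ->
  derive1 (cx G) r = 0 /\ derive1 (cy G) r = 0.
Proof. exact: hypot_eq0. Qed.

(** The speed cancels; where it vanishes, so does the derivative of the abscissa,
and both integrands are zero. *)
Lemma areaE G : area G = ip (cy G) (derive1 (cx G)).
Proof.
apply: eq_Rintegral => r _; rewrite /ds -mulrA; congr (_ * _).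
have [s0|sN0] := eqVneq (speed G r) 0; last by rewrite mulrAC mulVf// mul1r.
by have [-> _] := speed_eq0 s0; rewrite !(mulr0, mul0r).
Qed.

(** Expresses the boundary values through an L2 inner product, so that they are
continuous along L2-convergent families. *)
Lemma displacementE G : admissible G ->
  cx G 1 - cx G 0 = ip (derive1 (cx G)) (fun=> 1).
Proof.
move=> [rG [xG _]]; have [_ _ pG] := H1_sqint rG xG.
have I1 : (1 : R) \in `[0, 1] by rewrite in_itv/= ler01 lexx.
rewrite (pG 1 I1) addrC addKr.
by apply: eq_Rintegral => r _; rewrite mulr1.
Qed.

Lemma energyE sigma G : admissible G -> energy sigma G =
  \int[mu]_(r in unitI) hypot (derive1 (cx G) r) (derive1 (cy G) r)
  - sigma * ip (derive1 (cx G)) (fun=> 1).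
Proof. by move=> aG; rewrite /energy displacementE. Qed.

(** The right-hand side is the derivative of the length at G in the direction U,
as found in [length_differentiable]. *)
Lemma innerv_dsE G U : sqint (derive1 (cx G)) -> sqint (derive1 (cy G)) ->
  sqint (derive1 (cx U)) -> sqint (derive1 (cy U)) ->
  innerv G (dsv G G) (dsv G U) =
  ip (fun r => (hypot (derive1 (cx G) r) (derive1 (cy G) r))^-1 * derive1 (cx G) r)
     (derive1 (cx U)) +
  ip (fun r => (hypot (derive1 (cx G) r) (derive1 (cy G) r))^-1 * derive1 (cy G) r)
     (derive1 (cy U)).
Proof.
move=> sx sy sU sV; have [se1 se2] := sqint_unit sx sy.
rewrite /ip -RintegralD//; [|exact: integrable_ip..].
apply: eq_Rintegral => r _; rewrite /dot /dsv /ds /= -/(speed G r).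
have -> : hypot (derive1 (cx G) r) (derive1 (cy G) r) = speed G r by [].
have [->|sN0] := eqVneq (speed G r) 0; first by rewrite invr0 !mul0r addr0 mulr0.
by field.
Qed.

(** The right-hand side is the derivative of the area in the direction V, after
integration by parts. *)
Lemma inner_normalE G V : sqint (derive1 (cx G)) -> sqint (derive1 (cy G)) ->
  sqint (cx V) -> sqint (cy V) ->
  inner G (fun r => dot (normal G r) (V r)) (fun=> 1) =
  ip (cy V) (derive1 (cx G)) - ip (derive1 (cy G)) (cx V).
Proof.
move=> sx sy sU sV; rewrite /ip -RintegralB//; [|exact: integrable_ip..].
apply: eq_Rintegral => r _; rewrite /dot /normal /ds /=.
have [s0|sN0] := eqVneq (speed G r) 0.
  by have [-> ->] := speed_eq0 s0; rewrite s0 !(mulr0, mul0r) subrr.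
by rewrite -/(cx V r) -/(cy V r); field.
Qed.

(** Makes psi = 1 an admissible test function: it tests the total flux. *)
Lemma H1_cst1 G : admissible G -> H1 G (fun=> 1).
Proof.
move=> aG; have [_ _ sx sy] := admissible_sqint aG.
have d0 : derive1 (fun=> 1 : R) = (fun=> 0 : R).
  by apply/funext => r; rewrite derive1_cst.
split.
- split.
  + by apply: aeW => r _; exact: derivable_cst.
  + by rewrite d0; exact: integrable_cstI.
  + by move=> r _; rewrite d0 /Rintegral integral0_eq//= addr0.
- split; first exact: measurable_cst.
  have -> : (\int[mu]_(r in unitI) (`|1| ^+ 2 * speed G r)%:E =
      \int[mu]_(r in unitI) (EFin \o
        (fun r => hypot (derive1 (cx G) r) (derive1 (cy G) r))) r)%E.
    by apply: eq_integral => r _; rewrite normr1 expr1n mul1r.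
  apply: integrable_lty; first exact: measurable_itv.
  exact: sqint_integrable (sqint_hypot sx sy).
- rewrite d0; split; first exact: measurable_cst.
  by rewrite integral0_eq// => r _; rewrite normr0 expr0n mul0r.
Qed.

Lemma derivable_cvg_quotient f t : derivable f t 1 ->
  h^-1 * (f (t + h) - f t) @[h --> 0^'] --> derive1 f t.
Proof.
move=> df; rewrite derive1E.
have -> : (fun h => h^-1 * (f (t + h) - f t)) =
    (fun h => h^-1 *: ((f \o shift t) (h *: 1) - f t)).
  by apply/funext => h; rewrite /= /GRing.scale/= mulr1 [h + t]addrC.
exact: df.
Qed.

Lemma cvg_quotient_is_derive f t (d : R) :
  h^-1 * (f (t + h) - f t) @[h --> 0^'] --> d ->
  is_derive t 1 f d.
Proof.
have -> : (fun h => h^-1 * (f (t + h) - f t)) =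
    (fun h => h^-1 *: ((f \o shift t) (h *: 1) - f t)).
  by apply/funext => h; rewrite /= /GRing.scale/= mulr1 [h + t]addrC.
move=> fd; apply: DeriveDef; last exact/cvg_lim.
by apply/cvg_ex; exists d.
Qed.

(** The mean value theorem needs differentiability in the open half-line only. *)
Lemma nonincreasing_from_origin f d :
  (forall t : R, 0 < t -> h^-1 * (f (t + h) - f t) @[h --> 0^'] --> d t) ->
  (forall t : R, 0 < t -> d t <= 0) ->
  f h @[h --> 0^'+] --> f 0 ->
  forall s t : R, 0 <= s -> s <= t -> f t <= f s.
Proof.
move=> fd d0 f0 s t s0; rewrite le_eqVlt => /predU1P[->//|st].
have t0 : 0 < t by exact: le_lt_trans st.
have fder (r : R) : 0 < r -> is_derive r 1 f (d r).
  by move=> r0; apply: cvg_quotient_is_derive; exact: fd.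
have fc (r : R) : 0 < r -> {for r, continuous f}.
  move=> r0; apply: differentiable_continuous; apply/derivable1_diffP.
  by have := fder r r0; case.
apply: (@ler0_derive1_le_cc _ f 0 t) => //.
- by move=> r; rewrite in_itv/= => /andP[r0 _]; have := fder r r0; case.
- move=> r; rewrite in_itv/= => /andP[r0 _]; have Dr := fder r r0.
  by rewrite derive1E derive_val; exact: d0.
- apply/continuous_within_itvP => //; split=> //.
  + by move=> r; rewrite in_itv/= => /andP[r0 _]; exact: fc.
  + by apply: cvg_at_left_filter; exact: fc.
- by rewrite in_itv/= (ltW t0) lexx.
- by rewrite in_itv/= s0 (ltW st).
- exact: ltW.
Qed.

End Evolution.

(** * Conservation of area and decay of energy *)

Section InitialValues.
Context {R : realType} (L0 : R) (X0 : R -> R * R) (X : R -> R -> R * R).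
Local Notation mu := (@lebesgue_measure R).
Hypothesis init : initial_curve L0 X0 X.

Let L0_gt0 : 0 < L0. Proof. by case: init. Qed.

Lemma initial_derive1 r : r \in `]0, 1[ ->
  derive1 (cx (X 0)) r = L0 * derive1 (cx X0) (L0 * r) /\
  derive1 (cy (X 0)) r = L0 * derive1 (cy X0) (L0 * r).
Proof.
move=> r01; have [_ _ X0E _ _] := init.
have near_r : \forall q \near r, X 0 q = X0 (L0 * q).
  have : \forall q \near r, q \in `]0, 1[ by exact: near_in_itvoo.
  by apply: filterS => q /subset_itv_oo_cc; exact: X0E.
have L0N0 : L0 != 0 by rewrite gt_eqF.
rewrite -!derive1_scale// !derive1E; split; apply: near_eq_derive.
- by apply: filterS near_r => q; rewrite /cx => ->.
- by apply: filterS near_r => q; rewrite /cy => ->.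
Qed.

(** The chain rule multiplies the unit speed by L0. *)
Lemma initial_speed : {ae mu, forall r, r \in `[0, 1] -> speed (X 0) r = L0}.
Proof.
have [_ unit_speed _ _ _] := init.
apply: ae_closed01; apply: ae_imply (ae_scale L0_gt0 unit_speed) => r sp r01.
have [dx dy] := initial_derive1 r01.
have -> : speed (X 0) r = L0 * speed X0 (L0 * r).
  rewrite /speed /dot /dpar /= dx dy.
  set a := derive1 _ _; set b := derive1 _ _.
  have -> : L0 * a * (L0 * a) + L0 * b * (L0 * b) = L0 ^+ 2 * (a * a + b * b).
    by ring.
  by rewrite sqrtrM ?sqr_ge0// sqrtr_sqr ger0_norm// ltW.
rewrite sp ?mulr1//.
move: r01; rewrite !in_itv/= => /andP[r0 r1].
by rewrite mulr_ge0 ?(ltW L0_gt0) ?(ltW r0)//= ler_piMr ?(ltW L0_gt0) ?(ltW r1).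
Qed.

Lemma initial_admissible : admissible (X 0).
Proof.
split; last by case: init.
exists L0 => //; apply: ae_imply initial_speed => r sp r01.
by rewrite sp.
Qed.

Lemma initial_length : curve_length (X 0) = L0.
Proof.
have [_ _ sx sy] := admissible_sqint initial_admissible.
have [ms _] := sqint_hypot sx sy.
transitivity (\int[mu]_(r in unitI) L0); last first.
  by rewrite Rintegral_cst// [X in fine X]lebesgue_unitI mulr1.
congr fine; apply: ae_eq_integral => //.
- exact/measurable_EFinP.
- apply: ae_imply initial_speed => r sp Ir; congr EFin.
  exact: sp.
Qed.

Lemma initial_area :
  area (X 0) = \int[mu]_(s in `[0, L0]) (cy X0 s * derive1 (cx X0) s).
Proof.
have [_ _ X0E _ _] := init.
have [sx sy sx' sy'] := admissible_sqint initial_admissible.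
rewrite areaE (@Rintegral_scale _ _ _
  (fun r => L0^-1 * (cy (X 0) r * derive1 (cx (X 0)) r)))//.
- rewrite RintegralZl//; last exact: integrable_ip.
  by rewrite mulVKf// gt_eqF.
- by apply: integrableZI; exact: integrable_ip.
- move=> r r01; have [-> _] := initial_derive1 r01.
  rewrite /cy X0E; last exact: subset_itv_oo_cc.
  by rewrite mulrCA mulKf// gt_eqF.
Qed.

End InitialValues.

Section Conservation.
Context {R : realType} (sigma eta L0 : R) (X0 : R -> R * R)
  (X : R -> R -> R * R) (kappa : R -> R -> R).
Local Notation mu := (@lebesgue_measure R).
Hypotheses (eta_gt0 : 0 < eta)
  (sol : variational_solution sigma eta L0 X0 X kappa).

Let init : initial_curve L0 X0 X. Proof. by case: sol. Qed.

Lemma solution_admissible (t : R) : 0 <= t -> admissible (X t).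
Proof.
rewrite le_eqVlt => /predU1P[<-|t0]; first exact: initial_admissible init.
by have [_ _ /(_ t t0)[[? ? _ _] _ _ _]] := sol.
Qed.

(** Conservation of mass: test with psi = 1. *)
Lemma area_rate (t : R) : 0 < t ->
  h^-1 * (area (X (t + h)) - area (X t)) @[h --> 0^'] --> 0.
Proof.
move=> t0; have at_ := solution_admissible (ltW t0).
have [_ _ /(_ t t0)[[_ _ dt _] _ flow _]] := sol.
have [sx sy sx' sy'] := admissible_sqint at_.
have [rt [_ [yt y0 y1]]] := at_; have [_ _ py] := H1_sqint rt yt.
have [_ [xV [yV _ _]] _] := dt.
have [sVx sVx' pVx] := H1_sqint rt xV; have [sVy _ _] := H1_sqint rt yV.
have [_ cy_ cx'_ _] := time_differentiable_L2cvg t0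
  (fun s s0 => solution_admissible (ltW s0)) dt.
have rate d : ip (cy (dtime X t)) (derive1 (cx (X t))) +
    ip (cy (X t)) (derive1 (cx (dtime X t))) = d ->
    h^-1 * (area (X (t + h)) - area (X t)) @[h --> 0^'] --> d.
  have -> : (fun h => h^-1 * (area (X (t + h)) - area (X t))) =
      (fun h => h^-1 * (ip (cy (X (t + h))) (derive1 (cx (X (t + h))))
                        - ip (cy (X t)) (derive1 (cx (X t))))).
    by apply/funext => h; rewrite !areaE.
  by move=> <-; exact: (ip_differentiable sy sx' cy_ cx'_).
apply: rate.
have parts := ip_by_parts sy sy' sVx sVx' py pVx.
rewrite y0 y1 !mul0r subrr in parts.
have := flow _ (H1_cst1 at_).
rewrite (inner_normalE (V := dtime X t) sx' sy' sVx sVy).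
have -> : inner (X t) (ds (X t) (kappa t)) (ds (X t) (fun=> 1)) = 0.
  rewrite /inner /Rintegral integral0_eq// => r _.
  by rewrite {2}/ds derive1_cst !(mulr0, mul0r).
by rewrite addr0 => /subr0_eq ->.
Qed.

(** Dissipation: test with psi = kappa and omega = d_t X; the mixed terms
(kappa, n . d_t X) cancel. *)
Lemma energy_rate (t : R) : 0 < t -> exists2 d : R, d <= 0 &
  h^-1 * (energy sigma (X (t + h)) - energy sigma (X t)) @[h --> 0^'] --> d.
Proof.
move=> t0; have at_ := solution_admissible (ltW t0).
have [_ _ /(_ t t0)[[_ _ dt Hk] _ flow curv]] := sol.
have [sx sy sx' sy'] := admissible_sqint at_.
have [rt _] := at_; have [c c0 ct] := rt.
have [dX XV _] := dt; have [xV [yV _ _]] := XV.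
have [sVx sVx' _] := H1_sqint rt xV; have [sVy sVy' _] := H1_sqint rt yV.
have [_ _ cx'_ cy'_] := time_differentiable_L2cvg t0
  (fun s s0 => solution_admissible (ltW s0)) dt.
have clen := length_differentiable c0 ct sx' sy' cx'_ cy'_.
rewrite -innerv_dsE// in clen; set Q := innerv _ _ _ in clen.
have I0 : (0 : R) \in `[0, 1] by rewrite in_itv/= ler01 lexx.
have I1 : (1 : R) \in `[0, 1] by rewrite in_itv/= ler01 lexx.
have cl := derivable_cvg_quotient (dX 0 I0).1.
have cr := derivable_cvg_quotient (dX 1 I1).1.
pose l' := derive1 (xcl X) t; pose r' := derive1 (xcr X) t.
exists (Q - sigma * (r' - l')).
  have := flow _ Hk; have := curv _ XV.
  rewrite -/Q -/l' -/r' -[cx (dtime X t) 0]/l' -[cx (dtime X t) 1]/r'.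
  have -> : inner (X t) (kappa t) (fun r => dot (normal (X t) r) (dtime X t r)) =
      inner (X t) (fun r => dot (normal (X t) r) (dtime X t r)) (kappa t).
    by apply: eq_Rintegral => r _; congr (_ * _); rewrite mulrC.
  (* Dissipation along the curve by surface diffusion. *)
  have diss : 0 <= inner (X t) (ds (X t) (kappa t)) (ds (X t) (kappa t)).
    apply: Rintegral_ge0 => r _.
    by rewrite mulr_ge0 ?sqrtr_ge0// -expr2 sqr_ge0.
  (* Friction at the two contact points. *)
  have slip : 0 <= eta^-1 * (l' * l' + r' * r').
    by rewrite mulr_ge0 ?invr_ge0 ?(ltW eta_gt0)// addr_ge0// -expr2 sqr_ge0.
  set S := inner (X t) _ (kappa t); set D := inner _ _ _ in diss *.
  by clearbody S D Q l' r'; lra.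
have cends : sigma * (h^-1 * (cx (X (t + h)) 1 - cx (X t) 1) -
    h^-1 * (cx (X (t + h)) 0 - cx (X t) 0)) @[h --> 0^'] --> sigma * (r' - l').
  by apply: cvgMl_tmp; exact: cvgB.
apply: cvg_trans (cvgB clen cends); apply: near_eq_cvg; near=> h.
have alg (k l l0 a a0 b b0 : R) :
    k * (l - l0) - sigma * (k * (a - a0) - k * (b - b0)) =
    k * (l - sigma * (a - b) - (l0 - sigma * (a0 - b0))) by ring.
exact: alg.
Unshelve. all: by end_near. Qed.

Lemma area_energy_right_continuous :
  area (X h) @[h --> 0^'+] --> area (X 0) /\
  energy sigma (X h) @[h --> 0^'+] --> energy sigma (X 0).
Proof.
have [_ cX _] := sol.
have [_ cy_ cx'_ cy'_] := initially_continuous_L2cvg solution_admissible cX.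
have a0 := solution_admissible (lexx 0); have [[c c0 c0X] _] := a0.
split.
  have -> : (fun h => area (X h)) =
      (fun h => ip (cy (X h)) (derive1 (cx (X h)))).
    by apply/funext => h; rewrite areaE.
  by rewrite areaE; exact: (L2cvg_ip cy_ cx'_).
rewrite energyE//.
have cends : sigma * ip (derive1 (cx (X h))) (fun=> 1) @[h --> 0^'+] -->
    sigma * ip (derive1 (cx (X 0))) (fun=> 1).
  apply: cvgMl_tmp; apply: (L2cvg_ip cx'_); apply: L2cvg_cst.
  exact: sqint_cst.
apply: cvg_trans (cvgB (length_continuous c0 c0X cx'_ cy'_) cends); apply: near_eq_cvg; near=> t.
by rewrite /= energyE//; apply: solution_admissible.
Unshelve. all: by end_near. Qed.

End Conservation.

Theorem proposition2p1 (R : realType) (sigma eta L0 : R)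
    (X0 : R -> R * R) (X : R -> R -> R * R) (kappa : R -> R -> R)
    (hsigma : -1 < sigma < 1) (heta : 0 < eta)
    (hsol : variational_solution sigma eta L0 X0 X kappa) :
  (forall t : R, 0 <= t ->
     area (X t) = area (X 0) /\
     area (X 0) =
       \int[@lebesgue_measure R]_(s in `[0, L0]) (cy X0 s * derive1 (cx X0) s)) /\
  (forall t t' : R, 0 <= t' -> t' <= t ->
     energy sigma (X t) <= energy sigma (X t') /\
     energy sigma (X t') <= energy sigma (X 0) /\
     energy sigma (X 0) = L0 - sigma * (xcr X 0 - xcl X 0)).
Proof.
have [init _ _] := hsol.
have [area0 energy0] := area_energy_right_continuous hsol.
split.
  move=> t t0; split; last exact: initial_area init.
  apply/eqP; rewrite eq_le; apply/andP; split.
    apply: (@nonincreasing_from_origin _ (fun t => area (X t)) (fun=> 0)) => //.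
    by move=> s s0; exact: area_rate hsol s s0.
  rewrite -lerN2.
  apply: (@nonincreasing_from_origin _ (fun t => - area (X t)) (fun=> 0)) => //.
    move=> s s0.
    have -> : (fun h => h^-1 * (- area (X (s + h)) - - area (X s))) =
        (fun h => - (h^-1 * (area (X (s + h)) - area (X s)))).
      by apply/funext => h; rewrite -mulrN opprD.
    have rate := cvgN (area_rate hsol s0); rewrite oppr0 in rate.
    exact: rate.
  exact: cvgN.
have rate (t : R) : exists d : R, 0 < t -> d <= 0 /\
    h^-1 * (energy sigma (X (t + h)) - energy sigma (X t)) @[h --> 0^'] --> d.
  have [t0|_] := ltP 0 t; last by exists 0.
  by have [d d0 dt] := energy_rate heta hsol t0; exists d.
have [d dP] := choice rate.
have dec := @nonincreasing_from_origin _ (fun t => energy sigma (X t)) d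
  (fun t t0 => (dP t t0).2) (fun t t0 => (dP t t0).1) energy0.
move=> t t' t'0 t't; split; [exact: dec|split; first exact: dec].
by rewrite /energy (initial_length init).
Qed.
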